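(* Let $(X,0)$ be a complex surface germ with an isolated singularity. Let $G=(\ell_1,\dots,\ell_k)$ be a generating system of the maximal ideal $\mathfrak m$ of $\mathcal O_{X,0}$, let $\pi:(X_\pi,E)\to(X,0)$ be a good resolution of $(X,0)$, and let $E_v$ be an irreducible component of $E$. Then $$m_v(G)=m_v(\mathfrak m):=\inf\{m_v(h)\mid h\in\mathfrak m\}$$ and $$\nu_v(G)=\nu_v(\mathfrak m):=\inf\{\mathrm{Ord}_{E_v}(\pi^*(\mathrm dh_1\wedge\mathrm dh_2))\mid h_1,h_2\in\mathfrak m\}.$$ Consequently, $$q_v^G=q_v^{\mathfrak m}:=\frac{\nu_v(\mathfrak m)-m_v(\mathfrak m)+1}{m_v(\mathfrak m)}.$$
   Context: Complex surface germs are reduced and irreducible. A good resolution $\pi:(X_\pi,E)\to(X,0)$ is a proper bimeromorphic morphism with $X_\pi$ a smooth surface, biholomorphic over $X\setminus\mathrm{Sing}(X)$, with $E=\pi^{-1}(0)$ a simple normal crossing divisor. For a component $E_v$ of $E$, $m_v(h)$ is the order of vanishing of $h\circ\pi$ along $E_v$. For a generating system $G$ of an ideal, $LC(G)$ is the set of all $\mathbb C$-linear combinations of its elements, and $$m_v(G)=\inf_{h\in LC(G)}m_v(h),\quad\nu_v(G)=\inf_{h_1,h_2\in LC(G)}\mathrm{Ord}_{E_v}(\pi^*(\mathrm dh_1\wedge\mathrm dh_2)),\quad q_v^G=\frac{\nu_v(G)-m_v(G)+1}{m_v(G)},$$ where $\mathrm{Ord}_{E_v}$ of a holomorphic $2$-form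 is its order of vanishing along $E_v$. *)

(* Defs.v *)
From HB Require Import structures.
From mathcomp Require Import all_boot all_order all_algebra.
From mathcomp Require Import complex.
From mathcomp Require Import all_classical all_reals all_analysis.

Set Implicit Arguments.
Unset Strict Implicit.
Unset Printing Implicit Defensive.

Import Order.TTheory GRing.Theory Num.Theory.
Import numFieldNormedType.Exports.

Local Open Scope classical_set_scope.
Local Open Scope complex_scope.
Local Open Scope ring_scope.

(* Reduced complex spaces are modelled as topological spaces with a sheaf of
   complex valued functions.  Functions are total, and a germ at [p] is given by
   any function representing it: only the values near [p] are ever used. *)

(* Giving [R[i]] as a [numClosedFieldType] is what makes the topology and norm
   of [numFieldNormedType] available on it. *)
Definition Cplx (R : realType) : numClosedFieldType := R[i].

(* [f] agrees near [p] with the sum of a convergent power series centred at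
   [p].  In the order of [Cplx R], [0 < r] means that [r] is a positive real
   number (and the bound [B] has to be real too); the second clause is absolute
   convergence on the closed polydisc of radius [r]. *)
Definition holomorphic_at (R : realType) n (p : 'rV[Cplx R]_n)
    (f : 'rV[Cplx R]_n -> Cplx R) : Prop :=
  exists (c : {ffun 'I_n -> nat} -> Cplx R) (r B : Cplx R),
  [/\ 0 < r,
      forall N : nat, \sum_(a : {ffun 'I_n -> 'I_N})
        `|c [ffun i => val (a i)]| * r ^+ (\sum_i a i)%N <= B &
      \forall z \near p,
        (fun N : nat => \sum_(a : {ffun 'I_n -> 'I_N})
           c [ffun i => val (a i)] * \prod_i ((z : 'rV[Cplx R]_n) 0 i - p 0 i) ^+ a i)
        @ \oo --> f z].

(* [germ p f]: the function [f] is holomorphic near [p]. *)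
Record cspace (R : realType) := CSpace {
  points :> topologicalType;
  germ : points -> set (points -> Cplx R) }.

Definition affine (R : realType) n : cspace R :=
  @CSpace R 'rV[Cplx R]_n (@holomorphic_at R n).

(* The reduced structure on a subset [X] of [C^n]: holomorphic functions are
   the local restrictions of holomorphic functions of the ambient space. *)
Definition embedded (R : realType) n (X : set 'rV[Cplx R]_n) : cspace R :=
  @CSpace R (set_type X) (fun p f =>
    exists2 F : 'rV[Cplx R]_n -> Cplx R, holomorphic_at (set_val p) F &
      \forall q \near p, f q = F (set_val q)).

Definition holomorphic_map (R : realType) (A B : cspace R) (U : set A)
    (f : A -> B) : Prop :=
  forall p, U p -> {for p, continuous f} /\
    forall g : B -> Cplx R, germ (f p) g -> germ p (g \o f).

(* [f] is a biholomorphism of the open set [U] onto the open set [V], with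
   inverse [g]; the values of [f] off [U] and of [g] off [V] are irrelevant. *)
Definition biholomorphism (R : realType) (A B : cspace R)
    (U : set A) (V : set B) (f : A -> B) (g : B -> A) : Prop :=
  [/\ open U /\ open V,
      (forall p, U p -> V (f p) /\ g (f p) = p),
      (forall q, V q -> U (g q) /\ f (g q) = q),
      holomorphic_map U f &
      holomorphic_map V g].

Record chart (R : realType) (A : cspace R) (d : nat) := Chart {
  cdom : set A;
  cimg : set (affine R d);
  cmap : A -> affine R d;
  cinv : affine R d -> A;
  chart_biholomorphism : biholomorphism cdom cimg cmap cinv }.

Definition regular_point (R : realType) (A : cspace R) (d : nat) (p : A) :=
  exists phi : chart A d, cdom phi p.

Definition singular_locus (R : realType) (A : cspace R) : set A :=
  [set p | forall d, ~ regular_point d p].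
Arguments singular_locus {R} A.

Definition complex_manifold (R : realType) (d : nat) (M : cspace R) : Prop :=
  [/\ hausdorff_space M, @second_countable M &
      forall p : M, regular_point d p].

Definition analytic_near (R : realType) (A : cspace R) (p : A) (Z : set A) :=
  exists (s : nat) (f : 'I_s -> A -> Cplx R),
    (forall i, germ p (f i)) /\
    \forall q \near p, Z q <-> forall i, f i q = 0.

Definition analytic_subset (R : realType) (A : cspace R) (Z : set A) : Prop :=
  forall p, analytic_near p Z.

Definition irreducible_analytic (R : realType) (A : cspace R) (Z : set A) :=
  [/\ analytic_subset Z, Z !=set0 &
      forall Z1 Z2 : set A, analytic_subset Z1 -> analytic_subset Z2 ->
        Z = Z1 `|` Z2 -> Z = Z1 \/ Z = Z2].

Definition irreducible_component (R : realType) (A : cspace R)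
    (E C : set A) : Prop :=
  [/\ irreducible_analytic C, C `<=` E &
      forall C' : set A, irreducible_analytic C' -> C' `<=` E ->
        C `<=` C' -> C' = C].

Definition irreducible_germ (R : realType) (A : cspace R) (p : A) : Prop :=
  forall Z1 Z2 : set A, analytic_near p Z1 -> analytic_near p Z2 ->
    (\forall q \near p, Z1 q \/ Z2 q) ->
    (\forall q \near p, Z1 q) \/ (\forall q \near p, Z2 q).

(* [X] is a locally closed analytic subset of [C^n], i.e. a representative of
   the germ.  The germ [(X, o)] is irreducible, of dimension 2 (the dimension
   at [o] is that of the regular points near [o]), and [o] is an isolated point
   of the singular locus. *)
Definition isolated_surface_singularity (R : realType) n
    (X : set 'rV[Cplx R]_n) (o : embedded X) : Prop :=
  [/\ exists D : set 'rV[Cplx R]_n, [/\ open D, X `<=` D &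
        forall p, D p -> @analytic_near R (affine R n) p X],
      irreducible_germ o,
      (\forall q \near o, forall d, regular_point d q -> d = 2%N),
      singular_locus (embedded X) o &
      \forall q \near o, singular_locus (embedded X) q -> q = o].

Definition proper_map (T S : topologicalType) (f : T -> S) : Prop :=
  forall K : set S, compact K -> compact (f @^-1` K).

Definition biholomorphic_over (R : realType) (A B : cspace R) (f : A -> B)
    (V : set B) : Prop :=
  exists g : B -> A, biholomorphism (f @^-1` V) V f g.

Definition bimeromorphic (R : realType) (A B : cspace R) (f : A -> B) :=
  exists Z : set B, [/\ analytic_subset Z, dense (~` Z),
    dense (~` (f @^-1` Z)) & biholomorphic_over f (~` Z)].

(* On the domain of [phi] (a neighbourhood of [p]), the first coordinate is a
   reduced local equation of the smooth curve [C]. *)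
Definition adapted_chart (R : realType) (M : cspace R) (C : set M) (p : M)
    (phi : chart M 2) : Prop :=
  cdom phi p /\ forall q, cdom phi q -> C q <-> cmap phi q 0 0 = 0.

(* Normal crossings at every point, and smooth irreducible components. *)
Definition snc_divisor (R : realType) (M : cspace R) (E : set M) : Prop :=
  (forall p, E p -> exists phi : chart M 2,
     [/\ cdom phi p, cmap phi p = 0 &
         (forall q, cdom phi q -> E q <-> cmap phi q 0 0 = 0) \/
         (forall q, cdom phi q ->
            E q <-> cmap phi q 0 0 * cmap phi q 0 1 = 0)]) /\
  (forall C, irreducible_component E C ->
     forall p, C p -> exists phi : chart M 2, adapted_chart C p phi).

Definition good_resolution (R : realType) (X M : cspace R) (o : X)
    (pi : M -> X) : Prop :=
  [/\ complex_manifold 2 M,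
      holomorphic_map setT pi /\ proper_map pi,
      bimeromorphic pi,
      biholomorphic_over pi (~` singular_locus X) &
      snc_divisor (pi @^-1` [set o])].

Definition maximal_ideal (R : realType) (X : cspace R) (o : X) :
    set (X -> Cplx R) :=
  [set h | germ o h /\ h o = 0].

Definition generating_system (R : realType) (X : cspace R) (o : X)
    (I : set (X -> Cplx R)) k (G : 'I_k -> X -> Cplx R) : Prop :=
  (forall i, I (G i)) /\
  forall h, I h -> exists a : 'I_k -> X -> Cplx R,
    (forall i, germ o (a i)) /\
    \forall q \near o, h q = \sum_i a i q * G i q.

Definition LC (R : realType) (X : cspace R) k (G : 'I_k -> X -> Cplx R) :
    set (X -> Cplx R) :=
  [set h | exists c : 'I_k -> Cplx R, h = fun q => \sum_i c i * G i q].

(* [u phi] is the expression in the chart [phi] of a function, or the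
   coefficient of [dx /\ dy] of a 2-form.  The order along [C] is the largest
   [k] such that, at every point of [C], [u phi] is divisible by the [k]-th
   power of the local equation of [C]; it is [+oo] if there is no largest. *)
Definition vanishes_to_order (R : realType) (M : cspace R) (C : set M)
    (u : chart M 2 -> 'rV[Cplx R]_2 -> Cplx R) (k : nat) : Prop :=
  forall (p : M) (phi : chart M 2), C p -> adapted_chart C p phi ->
    exists2 g : 'rV[Cplx R]_2 -> Cplx R, holomorphic_at (cmap phi p) g &
      \forall z \near cmap phi p,
        u phi z = (z : 'rV[Cplx R]_2) 0 0 ^+ k * g z.

Definition order_along (R : realType) (M : cspace R) (C : set M)
    (u : chart M 2 -> 'rV[Cplx R]_2 -> Cplx R) : \bar R :=
  ereal_sup [set k%:R%:E | k in vanishes_to_order C u].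

Definition in_chart (R : realType) (M : cspace R) (f : M -> Cplx R)
    (phi : chart M 2) : 'rV[Cplx R]_2 -> Cplx R := f \o cinv phi.

(* The coefficient of [df /\ dg] on [dx /\ dy]. *)
Definition wedge_in_chart (R : realType) (M : cspace R) (f g : M -> Cplx R)
    (phi : chart M 2) : 'rV[Cplx R]_2 -> Cplx R :=
  let pd (j : 'I_2) (w : 'rV[Cplx R]_2 -> Cplx R) z := 'D_(delta_mx 0 j) w z in
  fun z => pd 0 (in_chart f phi) z * pd 1 (in_chart g phi) z
         - pd 1 (in_chart f phi) z * pd 0 (in_chart g phi) z.

Section Invariants.
Context (R : realType) (X M : cspace R) (pi : M -> X) (Ev : set M).
Local Open Scope ereal_scope.

Definition m_fun (h : X -> Cplx R) : \bar R :=
  order_along Ev (in_chart (h \o pi)).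

(* [pi^*(dh1 /\ dh2) = d(h1 o pi) /\ d(h2 o pi)]. *)
Definition ord_wedge (h1 h2 : X -> Cplx R) : \bar R :=
  order_along Ev (wedge_in_chart (h1 \o pi) (h2 \o pi)).

(* For [H = LC G] and for [H] the maximal ideal, these are the invariants of
   [G] and of the maximal ideal. *)
Definition m_inf (H : set (X -> Cplx R)) : \bar R :=
  ereal_inf [set m_fun h | h in H].

Definition nu_inf (H : set (X -> Cplx R)) : \bar R :=
  ereal_inf [set ord_wedge h.1 h.2 | h in H `*` H].

(* For the germs and components considered here, [nu_inf] and [m_inf] are finite
   and [m_inf] is positive, so that this is the quotient of real numbers. *)
Definition q_inf (H : set (X -> Cplx R)) : \bar R :=
  (nu_inf H - m_inf H + 1) / m_inf H.

End Invariants.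

(* Main.v *)
Require Import Defs.
From mathcomp Require Import all_boot all_order all_algebra.
From mathcomp Require Import complex ring lra zify.
From mathcomp Require Import all_classical all_reals all_analysis.

Set Implicit Arguments.
Unset Strict Implicit.
Unset Printing Implicit Defensive.

Import Order.TTheory GRing.Theory Num.Theory.
Import numFieldNormedType.Exports.

Local Open Scope classical_set_scope.
Local Open Scope complex_scope.
Local Open Scope ring_scope.

(** Since [LC G] lies in the maximal ideal [m], its infima are at least those of
    [m], and it must be shown that no element or pair of [m] does better than the
    generators [g_i] and the pairs of them.  Everything happens in a chart around
    a point of [Ev] in which [x = 0] is the local equation of [Ev]; there germs
    pull back to power series in two variables.

    For functions: [h = \sum_i a_i g_i] is divisible by [x ^ t] as soon as all
    the [g_i] are ([divisible_ideal]).

    For 2-forms, [d (a_i g_i)] involves [da_i] as well, and [a_i] is not in [LC G].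
    But [a_i] is a constant plus an element of [m], so that [da_i] is a
    combination of the [dg_j] plus terms [g_j dc_j].  The [g_j] vanish on [Ev],
    so that each such expansion multiplies the terms that are not yet expressed
    by the [dg_i /\ dg_j] by one more factor [x].  Hence if all
    [dg_i /\ dg_j] are divisible by [x ^ t], then after [t] expansions so are all
    [da /\ db] ([divisible_wedge]).

    An order along [Ev] is the supremum of a downward closed set of exponents,
    and [ereal_sup_nat_inter] turns these inclusions between sets of exponents
    into the inequalities between orders.

    What the argument uses of holomorphic functions is that convergent power
    series form a ring, have partial derivatives that are again power series, and
    are divisible by [x] when they vanish on [x = 0].  The proofs are elementary
    and use only completeness: they compare the partial sums over squares of a
    double series with those of the series of absolute values. *)

(** * Dominated convergence of sequences *)

(** Completeness in the form in which it is used: a sequence that is dominated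
    by a bounded nondecreasing one converges.  Everything about power series
    below holds over any [numFieldType] with this property. *)
Definition dominated_complete (C : numFieldType) :=
  forall (u A : nat -> C) (B : C),
    (forall m n, (m <= n)%N -> `|u n - u m| <= A n - A m) ->
    (forall n, A n <= B) ->
  exists l : C, u @ \oo --> l.

Section Convergence.
Variable C : numFieldType.
Implicit Types (u A : nat -> C).

Lemma squeeze_cvg0 u A : (forall n, `|u n| <= A n) -> A @ \oo --> (0 : C) ->
  u @ \oo --> (0 : C).
Proof.
move=> uA A0; apply/cvgr0Pnorm_lt => e e0.
near=> n; apply: le_lt_trans (uA n) _.
apply: le_lt_trans (real_ler_norm _) _.
  by apply: ger0_real; apply: le_trans (uA n).
by near: n; exact: cvgr0_norm_lt.
Unshelve. all: by end_near. Qed.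

Lemma cvg_norm_le u (l K : C) : u @ \oo --> l -> (forall n, `|u n| <= K) ->
  `|l| <= K.
Proof.
move=> ul uK; apply/ler_addgt0Pr => e e0.
move/cvgrPdist_lt: ul => /(_ _ e0) [n _ /(_ n (leqnn _))] /= h.
rewrite -(subrK (u n) l) addrC; apply: le_trans (ler_normD _ _) _.
by rewrite lerD // ltW.
Qed.

Lemma cvg_near_eq u (v : nat -> C) (l : C) : u @ \oo --> l ->
  (fun n => v n - u n) @ \oo --> (0 : C) -> v @ \oo --> l.
Proof.
move=> ul vu; have := cvgD ul vu; rewrite addr0.
rewrite (_ : u + _ = v); first exact.
by apply/funext => n; rewrite addrfctE addrC subrK.
Qed.

Lemma cvgn_half u (l : C) : u @ \oo --> l -> (fun n => u n./2) @ \oo --> l.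
Proof.
move=> ul; apply: (cvg_comp _ _ _ ul) => A [N _ NA].
by exists N.*2 => // n /= Nn; apply: NA => /=; rewrite -(doubleK N) half_leq.
Qed.

End Convergence.

Lemma pos_lower_bound (C : numFieldType) (r s : C) : 0 < r -> 0 < s ->
  exists t, [/\ 0 < t, t <= r & t <= s].
Proof.
move=> r0 s0; case: (real_leP (gtr0_real r0) (gtr0_real s0)) => [rs|/ltW sr].
- by exists r.
- by exists s.
Qed.

(** The difference is a sum over a part of the complement of [P], where [b]
    bounds [w]. *)
Lemma norm_sum_gap (C : numFieldType) (I : finType) (P Q : pred I)
    (w : I -> C) (b : I -> C) :
    (forall i, `|w i| <= b i) -> subpred P Q ->
  `|\sum_(i | Q i) w i - \sum_(i | P i) w i| <=
    \sum_i b i - \sum_(i | P i) b i.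
Proof.
move=> wb PQ.
have b0 i : 0 <= b i by apply: le_trans (wb i).
rewrite (bigID P Q)/= (bigID P xpredT)/=.
rewrite (eq_bigl P); last first.
  by move=> i; apply/andP/idP => [[]//|Pi]; split=> //; exact: PQ.
rewrite [X in `|X|]addrAC subrr add0r [leRHS]addrAC subrr add0r.
apply: le_trans (ler_norm_sum _ _ _) _.
apply: le_trans (ler_sum _ (fun i _ => wb i)) _.
rewrite [leRHS](bigID Q)/= [X in _ <= X + _](eq_bigl (fun i => Q i && ~~ P i)).
  by rewrite lerDl sumr_ge0.
by move=> i; rewrite andbC.
Qed.

Section ComplexComplete.
Variable R : realType.
Local Notation C := (Cplx R).

(** [v + a] is bounded and nondecreasing, like [a]. *)
Lemma dominated_cvg_real (v a : nat -> R) (b : R) :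
    (forall m n, (m <= n)%N -> `|v n - v m| <= a n - a m) ->
    (forall n, a n <= b) ->
  cvgn v.
Proof.
move=> vle ab.
have cvg_nd (w : nat -> R) (t : R) : (forall m n, (m <= n)%N -> w m <= w n) ->
    (forall n, w n <= t) -> cvgn w.
  move=> wnd wt; apply: nondecreasing_is_cvgn => //.
  by exists t => _ [n _ <-].
have ca : cvgn a.
  apply: (cvg_nd _ b) => // m n mn; rewrite -subr_ge0.
  exact: le_trans (normr_ge0 _) (vle _ _ mn).
have cva : cvgn (v \+ a).
  apply: (cvg_nd _ (v 0%N - a 0%N + b + b)) => /= [m n mn|n].
    have /ler_normlP[] := vle _ _ mn; lra.
  have /ler_normlP[_] := vle _ _ (leq0n n).
  by have := ab n; lra.
rewrite (_ : v = (v \+ a) \- a); last by apply/funext => n /=; rewrite addrK.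
exact: is_cvgB.
Qed.

Lemma cvg_complex_parts (u : nat -> C) (a b : R) :
    (fun n => complex.Re (u n)) @ \oo --> a ->
    (fun n => complex.Im (u n)) @ \oo --> b ->
  u @ \oo --> (a +i* b : C).
Proof.
move=> ua ub; apply/cvgrPdist_lt => e e0.
have eR : e = (complex.Re e)%:C by rewrite RRe_real// gtr0_real.
have d0 : 0 < complex.Re e / 2 by move: e0; rewrite eR ltcR => ?; lra.
move/cvgrPdist_lt: ua => /(_ _ d0) ua; move/cvgrPdist_lt: ub => /(_ _ d0) ub.
near=> n.
have uan : `|a - complex.Re (u n)| < complex.Re e / 2 by near: n; exact: ua.
have ubn : `|b - complex.Im (u n)| < complex.Re e / 2 by near: n; exact: ub.
have -> : (a +i* b : C) - u n =
    (a - complex.Re (u n))%:C + 'i%C * (b - complex.Im (u n))%:C.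
  by case: (u n) => x y; simpc.
apply: le_lt_trans (ler_normD _ _) _; rewrite normrM.
have n1 : `|'i%C : C| = 1 by rewrite normc_def /= expr0n add0r expr1n sqrtr1.
have nC (x : R) : `|x%:C : C| = (`|x|)%:C.
  by rewrite normc_def /= expr0n addr0 sqrtr_sqr.
rewrite n1 mul1r !nC -rmorphD /= eR ltcR; lra.
Unshelve. all: by end_near. Qed.

Lemma Cplx_complete : dominated_complete C.
Proof.
move=> u A B uA AB.
have ReB' (x y : C) : complex.Re (x - y) = complex.Re x - complex.Re y.
  by case: x y => ? ? [].
have ImB' (x y : C) : complex.Im (x - y) = complex.Im x - complex.Im y.
  by case: x y => ? ? [].
have ReA m n : (m <= n)%N ->
    complex.Re `|u n - u m| <= complex.Re (A n) - complex.Re (A m).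
  by move=> mn; have := uA _ _ mn; rewrite lecE ReB' => /andP[].
have ReB n : complex.Re (A n) <= complex.Re B.
  by have := AB n; rewrite lecE => /andP[].
have cR : cvgn (fun n => complex.Re (u n)).
  apply: (dominated_cvg_real _ ReB) => m n mn.
  apply: le_trans (ReA _ _ mn).
  rewrite -ReB' normc_def /= -sqrtr_sqr.
  by rewrite ler_wsqrtr// lerDl sqr_ge0.
have cI : cvgn (fun n => complex.Im (u n)).
  apply: (dominated_cvg_real _ ReB) => m n mn.
  apply: le_trans (ReA _ _ mn).
  rewrite -ImB' normc_def /= -sqrtr_sqr.
  by rewrite ler_wsqrtr// lerDr sqr_ge0.
by eexists; apply: cvg_complex_parts; [exact: cR|exact: cI].
Qed.

End ComplexComplete.

(** * Double power series *)

Section DoubleSeries.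
Variable C : numFieldType.
Hypothesis C_complete : dominated_complete C.
Implicit Types (c d : nat -> nat -> C) (x y r : C).

Definition psum c m n x y : C :=
  \sum_(i < m) \sum_(j < n) c i j * (x ^+ i * y ^+ j).

Definition normco c : nat -> nat -> C := fun i j => `|c i j|.

Definition majorized c r := exists B : C, forall N, psum (normco c) N N r r <= B.

Definition transpose c : nat -> nat -> C := fun i j => c j i.

Definition convolution c d : nat -> nat -> C := fun a b =>
  \sum_(i < a.+1) \sum_(j < b.+1) c i j * d (a - i)%N (b - j)%N.

Definition shift_co c : nat -> nat -> C := fun i j => c i.+1 j.

Definition deriv_co c : nat -> nat -> C := fun i j => i.+1%:R * c i.+1 j.

Lemma psum_pairs c m n N x y : (m <= N)%N -> (n <= N)%N ->
  psum c m n x y = \sum_(p : 'I_N * 'I_N | (p.1 < m)%N && (p.2 < n)%N)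
    c p.1 p.2 * (x ^+ p.1 * y ^+ p.2).
Proof.
move=> mN nN; rewrite /psum.
rewrite (big_ord_widen _ (fun i => \sum_(j < n) c i j * (x ^+ i * y ^+ j)) mN).
under eq_bigr => i _.
  rewrite (big_ord_widen _ (fun j => c i j * (x ^+ i * y ^+ j)) nN); over.
by rewrite pair_big.
Qed.

Lemma normco_term_ge0 c i j r : 0 <= r -> 0 <= normco c i j * (r ^+ i * r ^+ j).
Proof. by move=> r0; rewrite mulr_ge0 ?normr_ge0 ?mulr_ge0 ?exprn_ge0. Qed.

Lemma psum_norm_mono c m n N r : 0 <= r -> (m <= N)%N -> (n <= N)%N ->
  psum (normco c) m n r r <= psum (normco c) N N r r.
Proof.
move=> r0 mN nN; rewrite (psum_pairs _ _ _ mN nN) (psum_pairs _ _ _ (leqnn N) (leqnn N)).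
rewrite [leRHS](bigID (fun p : 'I_N * 'I_N => (p.1 < m)%N && (p.2 < n)%N))/=.
rewrite [X in _ <= X + _](eq_bigl (fun p : 'I_N * 'I_N => (p.1 < m)%N && (p.2 < n)%N)).
  by rewrite lerDl sumr_ge0// => p _; exact: normco_term_ge0.
by move=> p; rewrite !ltn_ord.
Qed.

Lemma norm_term_le c i j x y r s : `|x| <= r -> `|y| <= s ->
  `|c i j * (x ^+ i * y ^+ j)| <= `|c i j| * (r ^+ i * s ^+ j).
Proof.
move=> xr ys; rewrite !normrM !normrX.
by rewrite ler_wpM2l// ler_pM ?exprn_ge0// lerXn2r ?nnegrE// (le_trans _ xr, le_trans _ ys).
Qed.

Lemma psum_gap c M m n N r x y : `|x| <= r -> `|y| <= r ->
    (M <= m <= N)%N -> (M <= n <= N)%N ->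
  `|psum c m n x y - psum c M M x y| <=
    psum (normco c) N N r r - psum (normco c) M M r r.
Proof.
move=> xr yr /andP[Mm mN] /andP[Mn nN].
have MN := leq_trans Mm mN.
rewrite (psum_pairs _ _ _ mN nN) !(psum_pairs _ _ _ MN MN).
rewrite (psum_pairs _ _ _ (leqnn N) (leqnn N)).
rewrite [X in _ <= X - _](eq_bigl xpredT); last by move=> p; rewrite !ltn_ord.
apply: norm_sum_gap => [p|p /andP[pM qM]]; first exact: norm_term_le.
by rewrite (leq_trans pM)// (leq_trans qM).
Qed.

Lemma psum_cvg c r x y : majorized c r -> `|x| <= r -> `|y| <= r ->
  exists l : C, psum c N N x y @[N --> \oo] --> l.
Proof.
move=> [B cB] xr yr; apply: C_complete cB => m n mn.
by apply: psum_gap; rewrite // mn leqnn.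
Qed.

Lemma psum_norm_cvg c r : 0 <= r -> majorized c r ->
  exists l : C, psum (normco c) N N r r @[N --> \oo] --> l.
Proof.
move=> r0 cr; apply: (@psum_cvg _ r); rewrite ?ger0_norm//.
by case: cr => B cB; exists B => N; rewrite /normco; under eq_fun do under eq_fun do rewrite normr_id.
Qed.

(** Partial sums over almost square boxes have the limit of the square ones;
    shifting the first index produces such boxes. *)
Lemma psum_rect_cvg c r x y (l : C) : majorized c r -> `|x| <= r -> `|y| <= r ->
    psum c N N x y @[N --> \oo] --> l ->
  psum c N.+1 N x y @[N --> \oo] --> l.
Proof.
move=> cr xr yr cl; have r0 : 0 <= r by apply: le_trans xr.
have [a ca] := psum_norm_cvg r0 cr.
apply: (cvg_near_eq cl).
apply: (@squeeze_cvg0 _ _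
  (fun N => psum (normco c) N.+1 N.+1 r r - psum (normco c) N N r r)).
  by move=> N; apply: psum_gap => //; rewrite ?leqnSn ?leqnn.
rewrite -(subrr a); apply: cvgB => //.
by move: ca; rewrite -(@cvg_shiftS _ (fun N => psum (normco c) N N r r)).
Qed.

Lemma psum_transpose c m n x y : psum (transpose c) m n x y = psum c n m y x.
Proof.
rewrite /psum exchange_big; apply: eq_bigr => i _; apply: eq_bigr => j _.
by rewrite /transpose [y ^+ _ * _]mulrC.
Qed.

Lemma majorized_transpose c r : majorized c r -> majorized (transpose c) r.
Proof.
move=> [B cB]; exists B => N.
by rewrite (_ : normco _ = transpose (normco c))// psum_transpose.
Qed.

Lemma majorizedW c r s : 0 <= s -> s <= r -> majorized c r -> majorized c s.
Proof.
move=> s0 sr [B cB]; exists B => N; apply: le_trans (cB N).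
apply: ler_sum => i _; apply: ler_sum => j _.
by rewrite ler_wpM2l ?normr_ge0// ler_pM ?exprn_ge0// lerXn2r ?nnegrE ?(le_trans _ sr).
Qed.

Lemma triangle_sum N (F : nat -> nat -> C) :
  \sum_(a < N) \sum_(i < a.+1) F i (a - i)%N =
  \sum_(q : 'I_N * 'I_N | (q.1 + q.2 < N)%N) F q.1 q.2.
Proof.
transitivity (\sum_(a < N) \sum_(i < N | (i < a.+1)%N) F i (a - i)%N).
  apply: eq_bigr => a _.
  exact: (big_ord_widen _ (fun i => F i (a - i)%N) (ltn_ord a)).
rewrite (exchange_big_dep xpredT)//=.
rewrite -(pair_big_dep xpredT (fun i k : 'I_N => (i + k < N)%N) (fun i k : 'I_N => F i k))/=.
apply: eq_bigr => i _.
transitivity (\sum_(i <= a < N) F i (a - i)%N).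
  rewrite -(big_mkord (fun a => i < a.+1)%N (fun a => F i (a - i)%N)).
  by rewrite [RHS](big_nat_widenl _ 0%N)//; apply: eq_bigl => a; rewrite ltnS.
rewrite -{1}[i : nat]add0n big_addn.
rewrite (eq_bigr (fun k => F i k)) => [|k _]; last by rewrite addnK.
rewrite big_mkord (big_ord_widen _ (F i) (leq_subr i N)).
by apply: eq_bigl => k; rewrite ltn_subRL.
Qed.

Definition quad_term c d x y (i j k l : nat) : C :=
  c i j * (x ^+ i * y ^+ j) * (d k l * (x ^+ k * y ^+ l)).

Lemma psum_convolution c d N x y :
  psum (convolution c d) N N x y =
  \sum_(q : ('I_N * 'I_N) * ('I_N * 'I_N) |
      (q.1.1 + q.2.1 < N)%N && (q.1.2 + q.2.2 < N)%N)
    quad_term c d x y q.1.1 q.1.2 q.2.1 q.2.2.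
Proof.
pose sw (q : ('I_N * 'I_N) * ('I_N * 'I_N)) := ((q.1.1, q.2.1), (q.1.2, q.2.2)).
have swK : involutive sw by case=> [[? ?] [? ?]].
(* Pairing the two exponents of each variable separates the two triangular
   conditions. *)
rewrite (reindex_inj (inv_inj swK))/=.
pose G i k j l := quad_term c d x y i j k l.
rewrite -(pair_big (fun p : 'I_N * 'I_N => (p.1 + p.2 < N)%N)
  (fun p : 'I_N * 'I_N => (p.1 + p.2 < N)%N) (fun p q => G p.1 p.2 q.1 q.2))/=.
rewrite -(triangle_sum N (fun i k => \sum_(q : 'I_N * 'I_N | (q.1 + q.2 < N)%N) G i k q.1 q.2)).
apply: eq_bigr => a _.
under [RHS]eq_bigr => i _ do rewrite -(triangle_sum N (G i (a - i)%N)).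
rewrite exchange_big; apply: eq_bigr => b _.
rewrite /convolution mulr_suml; apply: eq_bigr => i _.
rewrite mulr_suml; apply: eq_bigr => j _.
have -> : x ^+ a = x ^+ i * x ^+ (a - i) by rewrite -exprD subnKC// leq_ord.
have -> : y ^+ b = y ^+ j * y ^+ (b - j) by rewrite -exprD subnKC// leq_ord.
by rewrite /G /quad_term; ring.
Qed.

Lemma psum_mul c d m N x y : (m <= N)%N ->
  psum c m m x y * psum d m m x y =
  \sum_(q : ('I_N * 'I_N) * ('I_N * 'I_N) |
      [&& q.1.1 < m, q.1.2 < m, q.2.1 < m & q.2.2 < m]%N)
    quad_term c d x y q.1.1 q.1.2 q.2.1 q.2.2.
Proof.
move=> mN; rewrite !(psum_pairs _ _ _ mN mN) big_distrlr pair_big/=.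
by apply: eq_bigl => q; rewrite -!andbA.
Qed.

(** The square partial sums of a product of series and the products of the
    square partial sums differ by terms that have an index at least [N / 2],
    and those are a tail of the product of the two majorant series. *)
Lemma psum_convolution_cvg c d r x y (a b : C) : majorized c r -> majorized d r ->
    `|x| <= r -> `|y| <= r ->
    psum c N N x y @[N --> \oo] --> a -> psum d N N x y @[N --> \oo] --> b ->
  psum (convolution c d) N N x y @[N --> \oo] --> a * b.
Proof.
move=> cr dr xr yr ca db; have r0 : 0 <= r by apply: le_trans xr.
have [A cA] := psum_norm_cvg r0 cr; have [B dB] := psum_norm_cvg r0 dr.
apply: (cvg_near_eq (cvgM ca db)).
pose T N := psum (normco c) N N r r * psum (normco d) N N r r.
apply: (@squeeze_cvg0 _ _ (fun N => T N - T N./2)).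
  move=> N; rewrite /T /= distrC psum_convolution.
  have h2 : (N./2 <= N)%N by lia.
  rewrite !(psum_mul _ _ _ _ (leqnn N)) !(psum_mul _ _ _ _ h2).
  rewrite [X in `|X - _|](eq_bigl xpredT); last by move=> q; rewrite !ltn_ord.
  rewrite [X in _ <= X - _](eq_bigl xpredT); last by move=> q; rewrite !ltn_ord.
  have le_term (q : ('I_N * 'I_N) * ('I_N * 'I_N)) :
      `|quad_term c d x y q.1.1 q.1.2 q.2.1 q.2.2| <=
      quad_term (normco c) (normco d) r r q.1.1 q.1.2 q.2.1 q.2.2.
    by rewrite normrM ler_pM// norm_term_le.
  apply: le_trans (norm_sum_gap le_term _) _ => //.
  rewrite lerB// [leRHS](bigID (fun q : ('I_N * 'I_N) * ('I_N * 'I_N) =>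
    [&& q.1.1 < N./2, q.1.2 < N./2, q.2.1 < N./2 & q.2.2 < N./2]%N))/=.
  rewrite [X in _ <= X + _](eq_bigl (fun q : ('I_N * 'I_N) * ('I_N * 'I_N) =>
    [&& q.1.1 < N./2, q.1.2 < N./2, q.2.1 < N./2 & q.2.2 < N./2]%N)).
    by rewrite lerDl sumr_ge0// => q _; apply: le_trans (le_term q).
  by move=> [[i j] [k l]] /=; lia.
rewrite -(subrr (A * B)); apply: cvgB; first exact: cvgM.
by apply: (@cvgn_half _ T); apply: cvgM.
Qed.

Lemma majorized_convolution c d r : 0 <= r -> majorized c r -> majorized d r ->
  majorized (convolution c d) r.
Proof.
move=> r0 [A cA] [B dB]; exists (A * B) => N.
have ge0 e : 0 <= psum (normco e) N N r r.
  by apply: sumr_ge0 => i _; apply: sumr_ge0 => j _; exact: normco_term_ge0.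
apply: (@le_trans _ _ (psum (convolution (normco c) (normco d)) N N r r)).
  apply: ler_sum => i _; apply: ler_sum => j _.
  rewrite ler_wpM2r ?mulr_ge0 ?exprn_ge0//.
  apply: le_trans (ler_norm_sum _ _ _) _; apply: ler_sum => k _.
  apply: le_trans (ler_norm_sum _ _ _) _; apply: ler_sum => l _.
  by rewrite normrM.
apply: (@le_trans _ _ (psum (normco c) N N r r * psum (normco d) N N r r)).
  rewrite psum_convolution (psum_mul _ _ _ _ (leqnn N)).
  rewrite [leRHS](bigID (fun q : ('I_N * 'I_N) * ('I_N * 'I_N) =>
    (q.1.1 + q.2.1 < N)%N && (q.1.2 + q.2.2 < N)%N))/=.
  rewrite [X in _ <= X + _](eq_bigl (fun q : ('I_N * 'I_N) * ('I_N * 'I_N) =>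
    (q.1.1 + q.2.1 < N)%N && (q.1.2 + q.2.2 < N)%N)).
    by rewrite lerDl sumr_ge0// => q _; rewrite mulr_ge0// normco_term_ge0.
  by move=> q; rewrite !ltn_ord.
by rewrite ler_pM.
Qed.

Lemma psum_shift c N x y :
  psum c N.+1 N x y = psum c 1 N x y + x * psum (shift_co c) N N x y.
Proof.
rewrite /psum big_ord_recl big_ord1; congr (_ + _).
rewrite mulr_sumr; apply: eq_bigr => i _; rewrite mulr_sumr; apply: eq_bigr => j _.
by rewrite /shift_co /= /bump /= add1n exprS; ring.
Qed.

Lemma majorized_shift c r : 0 < r -> majorized c r -> majorized (shift_co c) r.
Proof.
move=> r0 [B cB]; exists (B / r) => N; rewrite ler_pdivlMr// mulrC.
apply: le_trans (cB N.+1).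
apply: le_trans (psum_norm_mono c (ltW r0) (leqnn N.+1) (leqnSn N)).
rewrite psum_shift lerDr sumr_ge0// => i _; rewrite sumr_ge0// => j _.
by rewrite normco_term_ge0// ltW.
Qed.

(** At [x = 0] only the terms that the shift drops remain. *)
Lemma psum_divide_cvg c r x y (a b d : C) : majorized c r -> `|x| <= r -> `|y| <= r ->
    psum c N N x y @[N --> \oo] --> a -> psum c N N 0 y @[N --> \oo] --> b ->
    psum (shift_co c) N N x y @[N --> \oo] --> d ->
  a = b + x * d.
Proof.
move=> cr xr yr ca cb cd.
have c1 : psum c 1 N x y @[N --> \oo] --> b.
  have r0 : `|0 : C| <= r by rewrite normr0; apply: le_trans xr.
  have := psum_rect_cvg cr r0 yr cb.
  rewrite (_ : (fun N => psum c N.+1 N 0 y) = (fun N => psum c 1 N x y))//.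
  by apply/funext => N; rewrite psum_shift mul0r addr0 /psum !big_ord1.
have := psum_rect_cvg cr xr yr ca.
rewrite (_ : (fun N => psum c N.+1 N x y) =
  (fun N => psum c 1 N x y + x * psum (shift_co c) N N x y)).
  by move=> /cvg_unique; apply; [exact: norm_hausdorff|apply: cvgD => //; apply: cvgMl_tmp].
by apply/funext => N; rewrite psum_shift.
Qed.

(** The remainder is the sum of the terms ['C(i, m) x ^ (i - m) h ^ m] with
    [2 <= m] of the binomial expansion, of norm at most
    [|h| ^ 2 rho ^ (i - 2) (2 ^ i - 1 - i)].  Dropping the [1 + i] would break
    the induction on [i]. *)
Lemma pow_remainder (x h rho : C) i : `|x| <= rho -> `|h| <= rho ->
  `|(x + h) ^+ i - x ^+ i - i%:R * x ^+ i.-1 * h| * rho ^+ 2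
    + `|h| ^+ 2 * (rho ^+ i * i.+1%:R) <= `|h| ^+ 2 * (rho *+ 2) ^+ i.
Proof.
move=> xr hr; have r0 : 0 <= rho by apply: le_trans xr.
elim: i => [|i IH]; first by rewrite !expr0 subrr mul0r mul0r subr0 normr0 !mulr1 mul0r add0r.
set Q := _ - _ in IH.
have xi : x * (i%:R * x ^+ i.-1) = i%:R * x ^+ i.
  by case: i {IH Q} => [|i]; rewrite ?mul0r ?mulr0// exprS /=; ring.
have -> : (x + h) ^+ i.+1 - x ^+ i.+1 - i.+1%:R * x ^+ i.+1.-1 * h =
    (x + h) * Q + i%:R * x ^+ i.-1 * h ^+ 2.
  transitivity ((x + h) * Q + i%:R * x ^+ i.-1 * h ^+ 2
     + (x * (i%:R * x ^+ i.-1) - i%:R * x ^+ i) * h).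
    by rewrite /Q /= !exprS -natr1; ring.
  by rewrite xi subrr mul0r addr0.
have xi' : `|i%:R * x ^+ i.-1 * h ^+ 2| * rho ^+ 2 <= i%:R * rho ^+ i.+1 * `|h| ^+ 2.
  case: i {IH Q xi} => [|i]; first by rewrite !mul0r normr0 mul0r.
  rewrite !normrM normr_nat !normrX [leLHS](_ : _ = i.+1%:R * (`|x| ^+ i * rho ^+ 2) * `|h| ^+ 2); last by ring.
  have -> : rho ^+ i.+2 = rho ^+ i * rho ^+ 2 by rewrite -exprD addn2.
  by rewrite ler_wpM2r ?exprn_ge0// ler_wpM2l ?ler0n// ler_wpM2r ?exprn_ge0// lerXn2r ?nnegrE.
have xQ : `|(x + h) * Q| <= rho *+ 2 * `|Q|.
  by rewrite normrM ler_wpM2r// (le_trans (ler_normD _ _))// mulr2n lerD.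
apply: (@le_trans _ _ (rho *+ 2 * (`|Q| * rho ^+ 2 + `|h| ^+ 2 * (rho ^+ i * i.+1%:R)))); last first.
  by rewrite [X in _ <= _ * X]exprS [leRHS]mulrCA ler_wpM2l ?mulrn_wge0.
apply: (@le_trans _ _ ((rho *+ 2 * `|Q|) * rho ^+ 2 + i%:R * rho ^+ i.+1 * `|h| ^+ 2
    + `|h| ^+ 2 * (rho ^+ i.+1 * i.+2%:R))).
  rewrite lerD2r (le_trans (ler_wpM2r _ (ler_normD _ _))) ?exprn_ge0// mulrDl lerD//.
  by rewrite ler_wpM2r ?exprn_ge0.
by rewrite le_eqVlt; apply/orP; left; apply/eqP; rewrite (exprS rho i) mulr2n -(natr1 i.+1) -(natr1 i); ring.
Qed.

Lemma psum_deriv c N x y :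
  psum (deriv_co c) N N x y =
  \sum_(i < N.+1) \sum_(j < N) c i j * ((i%:R * x ^+ i.-1) * y ^+ j).
Proof.
rewrite big_ord_recl /= [X in _ = X + _]big1 ?add0r => [|j _]; last by rewrite !mul0r mulr0.
by apply: eq_bigr => i _; apply: eq_bigr => j _; rewrite /deriv_co /bump /= add1n; ring.
Qed.

(** Halving the radius pays for the factor [i], because [i <= 2 ^ i]. *)
Lemma majorized_deriv c rho : 0 < rho -> majorized c (rho *+ 2) ->
  majorized (deriv_co c) rho.
Proof.
move=> r0 [B cB]; exists (B / rho) => N; rewrite ler_pdivlMr//.
apply: le_trans (cB N.+1).
have r2 : 0 <= rho *+ 2 by rewrite mulrn_wge0// ltW.
apply: le_trans (psum_norm_mono c r2 (leqnn N.+1) (leqnSn N)).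
have -> : normco (deriv_co c) = deriv_co (normco c).
  by apply/funext => i; apply/funext => j; rewrite /normco /deriv_co normrM normr_nat.
rewrite psum_deriv mulr_suml; apply: ler_sum => i _.
rewrite mulr_suml; apply: ler_sum => j _.
have r0' := ltW r0.
have le_i : i%:R * rho ^+ i.-1 * rho <= (rho *+ 2) ^+ i.
  apply: (@le_trans _ _ (i%:R * rho ^+ i)).
    by case: {+}(i : nat) => [|k]; rewrite ?mul0r//= -mulrA -exprSr.
  rewrite -[rho *+ 2]mulr_natl exprMn ler_wpM2r ?exprn_ge0//.
  by rewrite -natrX ler_nat ltnW// ltn_expl.
have le_j : rho ^+ j <= (rho *+ 2) ^+ j.
  by rewrite lerXn2r ?nnegrE// mulr2n lerDl.
rewrite -mulrA ler_wpM2l ?normr_ge0// mulrAC.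
by apply: ler_pM => //; rewrite ?mulr_ge0 ?exprn_ge0.
Qed.

(** The bound is uniform in [h], so that it yields the derivative directly,
    without exchanging a limit and a sum. *)
Lemma deriv_estimate c (B x y h rho a b d : C) :
    0 < rho -> (forall N, psum (normco c) N N (rho *+ 2) (rho *+ 2) <= B) ->
    `|x| <= rho -> `|y| <= rho -> `|h| <= rho ->
    psum c N N x y @[N --> \oo] --> a ->
    psum c N N (x + h) y @[N --> \oo] --> b ->
    psum (deriv_co c) N N x y @[N --> \oo] --> d ->
  `|b - a - h * d| <= `|h| ^+ 2 * (B / rho ^+ 2).
Proof.
move=> r0 cB xr yr hr ca cb cd.
have r2 : 0 <= rho *+ 2 by rewrite mulrn_wge0// ltW.
have le2 (z : C) : `|z| <= rho -> `|z| <= rho *+ 2.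
  by move=> zr; apply: le_trans zr _; rewrite mulr2n lerDl ltW.
have xhr : `|x + h| <= rho *+ 2.
  by rewrite (le_trans (ler_normD _ _))// mulr2n lerD.
have cr : majorized c (rho *+ 2) by exists B.
have ca' := psum_rect_cvg cr (le2 _ xr) (le2 _ yr) ca.
have cb' := psum_rect_cvg cr xhr (le2 _ yr) cb.
apply: (cvg_norm_le (cvgB (cvgB cb' ca') (cvgMl_tmp (a := h) cd))) => N.
rewrite -[X in `|X|]/(psum c N.+1 N (x + h) y - psum c N.+1 N x y
  - h * psum (deriv_co c) N N x y) psum_deriv /psum.
rewrite mulr_sumr -!sumrB.
under eq_bigr do rewrite mulr_sumr -!sumrB.
rewrite mulrA ler_pdivlMr ?exprn_gt0//.
apply: (@le_trans _ _ (`|h| ^+ 2 * psum (normco c) N.+1 N (rho *+ 2) (rho *+ 2))); last first.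
  by rewrite ler_wpM2l ?exprn_ge0// (le_trans _ (cB N.+1))// psum_norm_mono.
rewrite /psum mulr_sumr -lter_pdivlMr ?exprn_gt0// mulr_suml.
apply: le_trans (ler_norm_sum _ _ _) _; apply: ler_sum => i _.
rewrite mulr_sumr mulr_suml.
apply: le_trans (ler_norm_sum _ _ _) _; apply: ler_sum => j _.
rewrite ler_pdivlMr ?exprn_gt0//.
set Q := (x + h) ^+ i - x ^+ i - i%:R * x ^+ i.-1 * h.
rewrite (_ : _ - _ = c i j * (Q * y ^+ j)); last by rewrite /Q; ring.
rewrite !normrM normrX.
have -> : `|c i j| * (`|Q| * `|y| ^+ j) * rho ^+ 2 = `|c i j| * ((`|Q| * rho ^+ 2) * `|y| ^+ j).
  by ring.
rewrite [leRHS]mulrCA ler_wpM2l ?normr_ge0// [leRHS]mulrA.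
have le_i : `|Q| * rho ^+ 2 <= `|h| ^+ 2 * (rho *+ 2) ^+ i.
  apply: le_trans (pow_remainder i xr hr).
  by rewrite lerDl mulr_ge0 ?exprn_ge0// mulr_ge0 ?exprn_ge0 ?ler0n// ltW.
have le_j : `|y| ^+ j <= (rho *+ 2) ^+ j by rewrite lerXn2r ?nnegrE// le2.
by apply: ler_pM => //; rewrite mulr_ge0// exprn_ge0// ltW.
Qed.

End DoubleSeries.

(** * Analytic functions of two variables *)

Section Analytic.
Variable C : numFieldType.
Hypothesis C_complete : dominated_complete C.
Implicit Types (c d : nat -> nat -> C) (p z : 'rV[C]_2) (f g : 'rV[C]_2 -> C).

Definition expands c p f := \forall z \near p,
  psum c N N ((z : 'rV[C]_2) 0 0 - p 0 0) (z 0 1 - p 0 1) @[N --> \oo] --> f z.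

Definition analytic_at p f :=
  exists c r, [/\ 0 < r, majorized c r & expands c p f].

Lemma near_coord_le p j (r : C) : 0 < r -> \forall z \near p, `|(z : 'rV[C]_2) 0 j - p 0 j| <= r.
Proof.
move=> r0; have /cvgrPdist_le/(_ _ r0) := @coord_continuous C 1 2 0 j p.
by apply: filterS => z; rewrite distrC.
Qed.

Lemma expands_eq c p f g : (\forall z \near p, f z = g z) -> expands c p f ->
  expands c p g.
Proof. by move=> fg; apply: filterS2 fg => z <-. Qed.

Lemma analytic_eq p f g : (\forall z \near p, f z = g z) -> analytic_at p f ->
  analytic_at p g.
Proof. by move=> fg [c [r [? ? /(expands_eq fg)]]]; exists c, r. Qed.

Lemma analytic_ext p f g : f =1 g -> analytic_at p f -> analytic_at p g.
Proof. by move=> /funext->. Qed.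

Lemma analytic_common p f g : analytic_at p f -> analytic_at p g ->
  exists c d r, [/\ 0 < r, majorized c r /\ majorized d r,
    expands c p f & expands d p g].
Proof.
move=> [c [r [r0 cr cf]]] [d [s [s0 ds dg]]].
have [t [t0 tr ts]] := pos_lower_bound r0 s0.
exists c, d, t; split=> //; split.
- exact: majorizedW (ltW t0) tr cr.
- exact: majorizedW (ltW t0) ts ds.
Qed.

Lemma psumD c d m n (x y : C) :
  psum (fun i j => c i j + d i j) m n x y = psum c m n x y + psum d m n x y.
Proof.
rewrite /psum -big_split; apply: eq_bigr => i _ /=.
by rewrite -big_split; apply: eq_bigr => j _; rewrite mulrDl.
Qed.

Lemma analyticD p f g : analytic_at p f -> analytic_at p g ->
  analytic_at p (fun z => f z + g z).
Proof.
move=> fp gp; have [c [d [r [r0 [[A cA] [B dB]] cf dg]]]] := analytic_common fp gp.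
exists (fun i j => c i j + d i j), r; split=> //.
  exists (A + B) => N; apply: le_trans (lerD (cA N) (dB N)); rewrite -psumD.
  apply: ler_sum => i _; apply: ler_sum => j _.
  by rewrite ler_wpM2r ?mulr_ge0 ?exprn_ge0 ?(ltW r0)// ler_normD.
apply: filterS2 cf dg => z cf dg.
rewrite (_ : (fun N => _) = (fun N => psum c N N (z 0 0 - p 0 0) (z 0 1 - p 0 1) +
    psum d N N (z 0 0 - p 0 0) (z 0 1 - p 0 1))); first exact: cvgD.
by apply/funext => N; rewrite psumD.
Qed.

Lemma analyticM p f g : analytic_at p f -> analytic_at p g ->
  analytic_at p (fun z => f z * g z).
Proof.
move=> fp gp; have [c [d [r [r0 [cr dr] cf dg]]]] := analytic_common fp gp.
exists (convolution c d), r; split=> //.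
  by apply: majorized_convolution => //; exact: ltW.
near=> z; apply: (psum_convolution_cvg C_complete cr dr); near: z => //; exact: near_coord_le.
Unshelve. all: by end_near. Qed.

Definition monomial_co (a : C) k : nat -> nat -> C :=
  fun i j => a *+ ((i == k) && (j == 0%N)).

Lemma psum_monomial a k N (x y : C) :
  psum (monomial_co a k) N N x y = a * x ^+ k *+ (k < N)%N.
Proof.
rewrite /psum; case: N => [|N]; first by rewrite big_ord0 ltn0.
transitivity (\sum_(i < N.+1 | i == k :> nat) a * x ^+ i).
  rewrite [RHS]big_mkcond; apply: eq_bigr => i _.
  rewrite big_ord_recl big1 => [|j _]; last by rewrite /monomial_co andbF mul0r.
  by rewrite /monomial_co andbT addr0 expr0 mulr1; case: eqP; rewrite ?mul0r.
case: ltnP => kN; last by rewrite big_pred0// => i; apply/eqP; move: (ltn_ord i); lia.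
by rewrite (big_pred1 (Ordinal kN)).
Qed.

Lemma analytic_monomial a k p : analytic_at p (fun z => a * (z 0 0 - p 0 0) ^+ k).
Proof.
exists (monomial_co a k), 1; split=> //.
  exists `|a| => N; rewrite (_ : normco _ = monomial_co `|a| k).
    by rewrite psum_monomial expr1n mulr1; case: ltnP => _ /=; rewrite ?mulr1n ?mulr0n ?normr_ge0.
  apply/funext => i; apply/funext => j; rewrite /normco /monomial_co.
  by case: (_ && _); rewrite ?normr0.
rewrite /expands; near=> z; under eq_fun do rewrite psum_monomial.
apply: cvg_near_cst; exists k.+1 => // N /= kN.
by rewrite kN.
Unshelve. all: by end_near. Qed.

Lemma analytic_cst a p : analytic_at p (fun=> a).
Proof.
by apply: analytic_ext (analytic_monomial a 0 p) => z; rewrite mulr1.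
Qed.

Lemma analytic_sum p n (F : 'I_n -> 'rV[C]_2 -> C) :
  (forall i, analytic_at p (F i)) -> analytic_at p (fun z => \sum_i F i z).
Proof.
elim: n F => [|n IH] F aF.
  by apply: analytic_ext (analytic_cst 0 p) => z; rewrite big_ord0.
apply: analytic_ext (analyticD (aF ord0) (IH _ (fun i => aF (lift ord0 i)))) => z.
by rewrite big_ord_recl.
Qed.

Definition slice p z : 'rV[C]_2 := \row_j if j == 0 then p 0 0 else z 0 j.

Lemma near_slice p (P : set 'rV[C]_2) : (\forall z \near p, P z) ->
  \forall z \near p, P (slice p z).
Proof.
move=> /nbhs_ballP[e e0 eP]; apply/nbhs_ballP; exists e => // z pz.
apply: eP; case: pz => _ pz; split=> // i j; rewrite mxE ord1.
by case: eqP => [->|_]; [exact: ballxx|rewrite -(ord1 i); exact: pz].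
Qed.

(** Dropping the terms without [x] from the series of [f] subtracts the values
    of [f] on the line [x = p 0 0], which are [0] by hypothesis; what remains is
    termwise divisible. *)
Lemma analytic_divide p f : analytic_at p f ->
    (\forall z \near p, (z : 'rV[C]_2) 0 0 = p 0 0 -> f z = 0) ->
  exists2 g, analytic_at p g & \forall z \near p, f z = ((z : 'rV[C]_2) 0 0 - p 0 0) * g z.
Proof.
move=> [c [r [r0 cr cf]]] f0.
have sr := majorized_shift r0 cr.
pose S z N := psum (shift_co c) N N (z 0 0 - p 0 0) (z 0 1 - p 0 1).
have S_lim : \forall z \near p, S z N @[N --> \oo] --> (lim (S z N @[N --> \oo]) : C).
  near=> z; have [l Sl] : exists l : C, S z N @[N --> \oo] --> l.
    by apply: (psum_cvg C_complete sr); near: z; exact: near_coord_le.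
  by apply: cvgP Sl.
exists (fun z => lim (S z N @[N --> \oo])).
  by exists (shift_co c), r.
have slice_p : \forall z \near p,
    psum c N N 0 ((z : 'rV[C]_2) 0 1 - p 0 1) @[N --> \oo] --> (0 : C).
  have := near_slice cf; have := near_slice f0.
  apply: filterS2 => {}z; rewrite /slice !mxE /= subrr.
  by move=> ->.
near=> z; rewrite -[RHS]add0r; apply: (psum_divide_cvg (y := z 0 1 - p 0 1) C_complete cr).
- by near: z; exact: near_coord_le.
- by near: z; exact: near_coord_le.
- by near: z.
- by near: z.
- by near: z.
Unshelve. all: by end_near. Qed.

Local Notation e_ j := (delta_mx 0 j : 'rV[C]_2).

Lemma is_derive_quadratic f z (v : 'rV[C]_2) (l K : C) :
    (\forall h \near (0 : C), `|f (z + h *: v) - f z - h * l| <= `|h| ^+ 2 * K) ->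
  is_derive z v f l.
Proof.
move=> quad.
have quot : (fun h => h^-1 *: ((f \o shift z) (h *: v) - f z)) @ 0^' --> l.
  apply/cvgrPdist_le => e e0.
  have K1 : 0 < `|K| + 1 by rewrite ltr_wpDl.
  have small : \forall h \near (0 : C)^', `|h| <= e / (`|K| + 1).
    by apply: dnbhs0_le; rewrite divr_gt0.
  have quad' : \forall h \near (0 : C)^', `|f (z + h *: v) - f z - h * l| <= `|h| ^+ 2 * K.
    exact: nbhs_dnbhs.
  near=> h.
  have h0 : h != 0 by near: h; exact: nbhs_dnbhs_neq.
  have hq : `|f (z + h *: v) - f z - h * l| <= `|h| ^+ 2 * K by near: h.
  have hs : `|h| <= e / (`|K| + 1) by near: h.
  have nh : 0 < `|h| by rewrite normr_gt0.
  have KR : K \is Num.real.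
    have : 0 <= `|h| ^+ 2 * K by exact: le_trans hq.
    by rewrite pmulr_rge0 ?exprn_gt0//; exact: ger0_real.
  rewrite distrC /= [h *: v + z]addrC.
  rewrite -(ler_pM2l nh) -normrM mulrBr /GRing.scale /= mulrA mulfV// mul1r.
  apply: le_trans hq _; rewrite expr2 -mulrA ler_pM2l//.
  move: hs; rewrite ler_pdivlMr// => hs; apply: le_trans hs.
  rewrite ler_wpM2l//.
  by apply: le_trans (real_ler_norm KR) _; rewrite lerDl.
split; first by apply: cvgP quot.
by apply: cvg_lim => //; exact: norm_hausdorff.
Unshelve. all: by end_near. Qed.

(** Stated for an arbitrary ordering [j], [j'] of the two coordinates, so as to
    serve for both partial derivatives. *)
Lemma expands_deriv c p f (j j' : 'I_2) (r : C) : 0 < r -> majorized c r -> j' != j ->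
    (\forall z \near p, psum c N N ((z : 'rV[C]_2) 0 j - p 0 j) (z 0 j' - p 0 j')
       @[N --> \oo] --> f z) ->
  exists df : 'rV[C]_2 -> C,
    (\forall z \near p, is_derive z (e_ j) f (df z)) /\
    (\forall z \near p, psum (deriv_co c) N N ((z : 'rV[C]_2) 0 j - p 0 j) (z 0 j' - p 0 j')
       @[N --> \oo] --> df z).
Proof.
move=> r0 cr jj' cf.
pose rho := r / 2.
have rho0 : 0 < rho by rewrite divr_gt0.
have rE : rho *+ 2 = r by rewrite -mulr_natr mulfVK// pnatr_eq0.
rewrite -rE in cr; have dr := majorized_deriv rho0 cr; have [B cB] := cr.
pose S z N := psum (deriv_co c) N N (z 0 j - p 0 j) (z 0 j' - p 0 j').
pose df (z : 'rV[C]_2) : C := lim (S z N @[N --> \oo]).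
have S_lim : \forall z \near p, S z N @[N --> \oo] --> df z.
  near=> z; have [l Sl] : exists l : C, S z N @[N --> \oo] --> l.
    by apply: (psum_cvg C_complete dr); near: z; exact: near_coord_le.
  by apply: cvgP Sl.
exists df; split=> //.
have cf2 := near_join cf.
near=> z.
have xr : `|z 0 j - p 0 j| <= rho by near: z; exact: near_coord_le.
have yr : `|z 0 j' - p 0 j'| <= rho by near: z; exact: near_coord_le.
have fz : psum c N N (z 0 j - p 0 j) (z 0 j' - p 0 j') @[N --> \oo] --> f z by near: z.
have dfz : S z N @[N --> \oo] --> df z by near: z.
have fz2 : \forall w \near z, psum c N N ((w : 'rV[C]_2) 0 j - p 0 j) (w 0 j' - p 0 j')
       @[N --> \oo] --> f w by near: z.
apply: (@is_derive_quadratic _ _ _ _ (B / rho ^+ 2)).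
have to_z : z + h *: e_ j @[h --> (0 : C)] --> z.
  have := cvgD (cvg_cst z) (@scalel_continuous C 'rV[C]_2 (e_ j) 0).
  by rewrite scale0r addr0; exact.
have hr : \forall h \near (0 : C), `|h| <= rho by exact: nbhs0_le.
have fzh := to_z _ fz2.
apply: filterS2 hr fzh => h hr.
rewrite /= !mxE !eqxx (negPf jj') mulr1 mulr0 addr0 => fzh.
apply: (deriv_estimate C_complete rho0 cB xr yr hr fz _ dfz).
by rewrite addrAC.
Unshelve. all: by end_near. Qed.

Lemma analytic_deriv p f j : analytic_at p f ->
  exists2 df, analytic_at p df & \forall z \near p, is_derive z (e_ j) f (df z).
Proof.
move=> [c [r [r0 cr cf]]].
have r2 : 0 < r / 2 by rewrite divr_gt0.
have rE : r = (r / 2) *+ 2 by rewrite -mulr_natr mulfVK// pnatr_eq0.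
case: (eqVneq j 0) => [->|j1].
  have [df [fdf cdf]] := @expands_deriv c p f 0 1 r r0 cr isT cf.
  exists df => //; exists (deriv_co c), (r / 2); split=> //.
  by apply: majorized_deriv; rewrite -?rE.
have {j1}-> : j = 1 by apply/val_inj; case: j j1 => [[|[|]]].
have [] := @expands_deriv (transpose c) p f 1 0 r r0 (majorized_transpose cr) isT.
  by apply: filterS cf => z; under eq_fun do rewrite -psum_transpose.
move=> df [fdf cdf]; exists df => //.
exists (transpose (deriv_co (transpose c))), (r / 2); split=> //.
  apply: majorized_transpose; apply: majorized_deriv => //.
  by rewrite -rE; exact: majorized_transpose.
by apply: filterS cdf => z; under eq_fun do rewrite -psum_transpose.
Qed.

End Analytic.

(** * The coefficient of [df /\ dg] *)

Section Wedge.
Variable C : numFieldType.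
Hypothesis C_complete : dominated_complete C.
Local Notation V := 'rV[C]_2.
Implicit Types (p : V) (f g h : V -> C).

Local Notation e_ j := (delta_mx 0 j : V).

Definition wedge f g : V -> C := fun z =>
  'D_(e_ 0) f z * 'D_(e_ 1) g z - 'D_(e_ 1) f z * 'D_(e_ 0) g z.

Lemma near_derivable p f j : analytic_at p f -> \forall z \near p, derivable f z (e_ j).
Proof. by move=> /(analytic_deriv C_complete j)[df _]; apply: filterS => z []. Qed.

Lemma analytic_derive p f j : analytic_at p f -> analytic_at p (fun z => 'D_(e_ j) f z).
Proof.
move=> /(analytic_deriv C_complete j)[df adf fdf]; apply: analytic_eq adf.
by apply: filterS fdf => z [].
Qed.

Lemma analytic_wedge p f g : analytic_at p f -> analytic_at p g -> analytic_at p (wedge f g).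
Proof.
move=> af ag; pose M a b := analyticM C_complete (analytic_derive a af) (analytic_derive b ag).
have aN := analyticM C_complete (analytic_cst (-1) p) (M 1 0).
by apply: analytic_ext (analyticD (M 0 1) aN) => z; rewrite mulN1r.
Qed.

Lemma wedge_antisym f g z : wedge f g z = - wedge g f z.
Proof. by rewrite /wedge opprB [X in X - _]mulrC [X in _ - X]mulrC. Qed.

Lemma near_wedge_eq p f g g' : (\forall z \near p, g z = g' z) ->
  \forall z \near p, wedge f g z = wedge f g' z.
Proof. by move=> /near_join; apply: filterS => z gg'; rewrite /wedge !(near_eq_derive _ gg'). Qed.

(** Differentiating [h] drops the constant, and the terms that involve [dc_i]
    keep the factor [g_i]. *)
Lemma near_wedge_leibniz p k (c g : 'I_k -> V -> C) (a : C) f h :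
    (forall i, analytic_at p (c i)) -> (forall i, analytic_at p (g i)) ->
    (\forall z \near p, h z = a + \sum_i c i z * g i z) ->
  \forall z \near p, wedge f h z =
    \sum_i (c i z * wedge f (g i) z + g i z * wedge f (c i) z).
Proof.
move=> ac ag /near_wedge_eq hE.
have dc (j : 'I_2) : \forall z \near p, forall i, derivable (c i) z (e_ j).
  by apply: (@filter_forall V _ (fun i z => derivable (c i) z (e_ j)) (nbhs p) _) => i; exact: near_derivable.
have dg (j : 'I_2) : \forall z \near p, forall i, derivable (g i) z (e_ j).
  by apply: (@filter_forall V _ (fun i z => derivable (g i) z (e_ j)) (nbhs p) _) => i; exact: near_derivable.
have D j : \forall z \near p, 'D_(e_ j) (fun z => a + \sum_i c i z * g i z) z =
    \sum_i (c i z * 'D_(e_ j) (g i) z + g i z * 'D_(e_ j) (c i) z).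
  apply: filterS2 (dc j) (dg j) => z dcz dgz.
  rewrite (_ : (fun z => _) = cst a + \sum_i (c i * g i)); last first.
    by apply/funext => w; rewrite addrfctE fct_sumE.
  rewrite deriveD//; last by apply: derivable_sum => i; exact: derivableM.
  rewrite derive_cst add0r derive_sum => [|i]; last exact: derivableM.
  by apply: eq_bigr => i _; rewrite deriveM.
near=> z; rewrite (near (hE f) z)// /wedge (near (D 0) z)// (near (D 1) z)//.
rewrite !mulr_sumr -sumrB; apply: eq_bigr => i _.
by ring.
Unshelve. all: by end_near. Qed.

(** * Divisibility by powers of the first coordinate *)

Definition divisible p (t : nat) f :=
  exists2 g, analytic_at p g & \forall z \near p, f z = (z : V) 0 0 ^+ t * g z.

Lemma divisible_eq p t f g : (\forall z \near p, f z = g z) -> divisible p t f ->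
  divisible p t g.
Proof. by move=> fg [q aq fq]; exists q => //; apply: filterS2 fg fq => z <-. Qed.

Lemma divisible0 p f : analytic_at p f -> divisible p 0 f.
Proof. by move=> af; exists f => //; near=> z; rewrite expr0 mul1r.
Unshelve. all: by end_near. Qed.

Lemma divisibleD p t f g : divisible p t f -> divisible p t g ->
  divisible p t (fun z => f z + g z).
Proof.
move=> [a aa fa] [b ab gb]; exists (fun z => a z + b z); first exact: analyticD.
by apply: filterS2 fa gb => z -> ->; rewrite mulrDr.
Qed.

Lemma divisibleM p s t f g : divisible p s f -> divisible p t g ->
  divisible p (s + t) (fun z => f z * g z).
Proof.
move=> [a aa fa] [b ab gb]; exists (fun z => a z * b z); first exact: analyticM.
by apply: filterS2 fa gb => z -> ->; rewrite exprD mulrACA.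
Qed.

Lemma divisible_mull p t f g : analytic_at p f -> divisible p t g ->
  divisible p t (fun z => f z * g z).
Proof. by move=> /divisible0 f0 /(divisibleM f0). Qed.

Lemma divisible_sum p t n (F : 'I_n -> V -> C) :
  (forall i, divisible p t (F i)) -> divisible p t (fun z => \sum_i F i z).
Proof.
move=> dF; have /choice[q qF] : forall i, exists q : V -> C, analytic_at p q /\
    \forall z \near p, F i z = (z : V) 0 0 ^+ t * q z.
  by move=> i; have [q] := dF i; exists q.
exists (fun z => \sum_i q i z); first by apply: analytic_sum => i; case: (qF i).
have : \forall z \near p, forall i, F i z = (z : V) 0 0 ^+ t * q i z.
  by apply: (@filter_forall V _ (fun i z => F i z = z 0 0 ^+ t * q i z) (nbhs p) _) => i; case: (qF i).
by apply: filterS => z Fq; rewrite mulr_sumr; apply: eq_bigr => i _.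
Qed.

Lemma divisible_pred p t f : p 0 0 = 0 -> divisible p t.+1 f -> divisible p t f.
Proof.
move=> p0 [q aq fq]; exists (fun z : V => z 0 0 * q z).
  apply: analyticM => //; apply: analytic_ext (analytic_monomial 1 1 p) => z.
  by rewrite p0 subr0 mul1r.
by apply: filterS fq => z ->; rewrite exprSr mulrA.
Qed.

Lemma divisibleW p s t f : p 0 0 = 0 -> (s <= t)%N -> divisible p t f -> divisible p s f.
Proof.
move=> p0 /subnK <-; elim: (t - s)%N => // n IH; rewrite addSn => /divisible_pred.
by move=> /(_ p0).
Qed.

Lemma divisible_of_zero p f : p 0 0 = 0 -> analytic_at p f ->
  (\forall z \near p, (z : V) 0 0 = 0 -> f z = 0) -> divisible p 1 f.
Proof.
move=> p0 af f0; have [|g ag fg] := analytic_divide C_complete af.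
  by apply: filterS f0 => z; rewrite p0.
by exists g => //; apply: filterS fg => z ->; rewrite p0 subr0.
Qed.

Lemma divisibleN p t f : divisible p t f -> divisible p t (fun z => - f z).
Proof.
move=> /(divisible_mull (analytic_cst (-1) p)) [q aq fq]; exists q => //.
by apply: filterS fq => z <-; rewrite mulN1r.
Qed.

(** [A] plays the role of a local ring whose elements are constants plus
    combinations of the [g i], which vanish on [x = 0].  Expanding [h] once gives
    [df /\ dh = \sum_i (c_i df /\ dg_i + g_i df /\ dc_i)]: if all the
    [df /\ dc_i] have order at least [s], the second terms have order at least
    [s + 1].  Starting from [s = 0], repeated expansion therefore pushes them
    beyond any bound, and only the [df /\ dg_i] limit the order; the same
    argument for [dg_i /\ df] reduces these to the [dg_i /\ dg_j]. *)
Lemma divisible_wedge p k (g : 'I_k -> V -> C) (A : set (V -> C)) t :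
    p 0 0 = 0 ->
    (forall f, A f -> analytic_at p f) ->
    (forall i, A (g i)) -> (forall i, divisible p 1 (g i)) ->
    (forall f, A f -> exists (a : C) (c : 'I_k -> V -> C), (forall i, A (c i)) /\
      \forall z \near p, f z = a + \sum_i c i z * g i z) ->
    (forall i j, divisible p t (wedge (g i) (g j))) ->
  forall f h, A f -> A h -> divisible p t (wedge f h).
Proof.
move=> p0 Aan Ag g1 Agen gg.
have step s f : (s < t)%N -> (forall i, divisible p t (wedge f (g i))) ->
    (forall h, A h -> divisible p s (wedge f h)) ->
  forall h, A h -> divisible p s.+1 (wedge f h).
  move=> st fg fs h Ah; have [a [c [Ac hE]]] := Agen h Ah.
  have := near_wedge_leibniz f (fun i => Aan _ (Ac i)) (fun i => Aan _ (Ag i)) hE.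
  move=> wE; apply: (@divisible_eq p _ (fun z =>
    \sum_i (c i z * wedge f (g i) z + g i z * wedge f (c i) z))).
    by apply: filterS wE.
  apply: divisible_sum => i; apply: divisibleD.
    by apply: divisible_mull; [exact/Aan/Ac|exact: divisibleW p0 st (fg i)].
  by apply: (divisibleM (g1 i)); exact: fs.
have bootstrap f : A f -> (forall i, divisible p t (wedge f (g i))) ->
    forall h, A h -> divisible p t (wedge f h).
  move=> Af fg; suff H s : (s <= t)%N -> forall h, A h -> divisible p s (wedge f h).
    exact: H.
  elim: s => [_ h Ah|s IH st]; first by apply/divisible0/analytic_wedge; exact: Aan.
  by apply: step => //; apply: IH; exact: ltnW.
move=> f h Af Ah; apply: (bootstrap f Af) => // i.
have := divisibleN (bootstrap _ (Ag i) (gg i) f Af).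
by apply: divisible_eq; near=> z; rewrite -wedge_antisym.
Unshelve. all: by end_near. Qed.

End Wedge.

(** * Power series in several variables and double series *)

(** [holomorphic_at] over an arbitrary [numFieldType]. *)
Definition power_series_at (C : numFieldType) n (p : 'rV[C]_n)
    (f : 'rV[C]_n -> C) : Prop :=
  exists (c : {ffun 'I_n -> nat} -> C) (r B : C),
  [/\ 0 < r,
      forall N : nat, \sum_(a : {ffun 'I_n -> 'I_N})
        `|c [ffun i => val (a i)]| * r ^+ (\sum_i a i)%N <= B &
      \forall z \near p,
        (fun N : nat => \sum_(a : {ffun 'I_n -> 'I_N})
           c [ffun i => val (a i)] * \prod_i ((z : 'rV[C]_n) 0 i - p 0 i) ^+ a i)
        @ \oo --> f z].

Section PowerSeries.
Variable C : numFieldType.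

Lemma power_series_at_affine n (p : 'rV[C]_n) (f g : 'rV[C]_n -> C) (b : C) :
  power_series_at p f -> power_series_at p g ->
  power_series_at p (fun z => f z + b * g z).
Proof.
move=> [c [r [B [r0 cB cf]]]] [d [s [D [s0 dD dg]]]].
have [t [t0 tr ts]] := pos_lower_bound r0 s0.
exists (fun a => c a + b * d a), t, (B + `|b| * D); split=> //.
- move=> N.
  apply: le_trans (lerD (cB N) (ler_wpM2l (normr_ge0 b) (dD N))).
  rewrite mulr_sumr -big_split; apply: ler_sum => a _ /=.
  have pow_le x : t <= x -> t ^+ (\sum_i a i) <= x ^+ (\sum_i a i).
    by move=> tx; rewrite lerXn2r ?nnegrE ?(ltW t0)// (le_trans (ltW t0)).
  apply: (@le_trans _ _ ((`|c [ffun i => val (a i)]| +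
      `|b| * `|d [ffun i => val (a i)]|) * t ^+ (\sum_i a i))).
    by rewrite ler_wpM2r ?exprn_ge0 ?(ltW t0)// -normrM ler_normD.
  rewrite mulrDl lerD ?mulrA ?ler_wpM2l ?mulr_ge0 ?normr_ge0// pow_le//.
- apply: filterS2 cf dg => z cf dg.
  rewrite (_ : (fun N => _) = (fun N => \sum_(a : {ffun 'I_n -> 'I_N})
      c [ffun i => val (a i)] * \prod_i ((z : 'rV[C]_n) 0 i - p 0 i) ^+ a i +
    b * \sum_(a : {ffun 'I_n -> 'I_N})
      d [ffun i => val (a i)] * \prod_i ((z : 'rV[C]_n) 0 i - p 0 i) ^+ a i)).
    by apply: cvgD => //; apply: cvgMl_tmp.
  apply/funext => N; rewrite mulr_sumr -big_split; apply: eq_bigr => a _ /=.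
  by rewrite mulrDl mulrA.
Qed.

Lemma power_series_at_cst n (p : 'rV[C]_n) (b : C) : power_series_at p (fun=> b).
Proof.
pose c (a : {ffun 'I_n -> nat}) := b *+ (a == [ffun=> 0%N]).
have sumE (x : 'I_n -> C) N : \sum_(a : {ffun 'I_n -> 'I_N.+1})
    c [ffun i => val (a i)] * \prod_i x i ^+ a i = b.
  rewrite (bigD1 [ffun=> ord0])//= [X in _ + X]big1 => [|a a0].
    rewrite addr0 /c (_ : _ == _)// ?mulr1n.
      by rewrite big1 ?mulr1// => i _; rewrite ffunE expr0.
    by apply/eqP/ffunP => i; rewrite !ffunE.
  rewrite /c (_ : _ == _ = false) ?mulr0n ?mul0r//.
  apply: contraNF a0 => /eqP/ffunP a0; apply/eqP/ffunP => i.
  by apply/val_inj; have := a0 i; rewrite !ffunE.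
exists c, 1, `|b|; split=> //.
  move=> N; under eq_bigr do rewrite expr1n mulr1.
  apply: (@le_trans _ _ (\sum_(a : {ffun 'I_n -> 'I_N} | [forall i, val (a i) == 0%N]) `|b|)).
    rewrite [leRHS]big_mkcond; apply: ler_sum => a _; rewrite /c.
    case: eqP => [/ffunP a0|_]; last by rewrite mulr0n normr0; case: ifP.
    rewrite ifT//; apply/forallP => i.
    by have := a0 i; rewrite !ffunE => ->.
  rewrite sumr_const -[leRHS]mulr1n ler_wpMn2l//.
  apply/card_le1_eqP => a a' /forallP a0 /forallP a0'.
  by apply/ffunP => i; apply/val_inj; rewrite /= (eqP (a0 i)) (eqP (a0' i)).
near=> z; apply: cvg_near_cst; exists 1%N => // N /= N0.
by rewrite -(prednK N0) sumE.
Unshelve. all: by end_near. Qed.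

Lemma sum_ffun_psum (c : {ffun 'I_2 -> nat} -> C) N (x : 'I_2 -> C) :
  \sum_(a : {ffun 'I_2 -> 'I_N}) c [ffun i => val (a i)] * \prod_i x i ^+ a i =
  psum (fun i j => c [ffun k : 'I_2 => if k == 0 then i else j]) N N (x 0) (x 1).
Proof.
rewrite /psum pair_big /=.
pose h (q : 'I_N * 'I_N) := [ffun k : 'I_2 => if k == 0 then q.1 else q.2].
rewrite (reindex h); last first.
  exists (fun a : {ffun 'I_2 -> 'I_N} => (a 0, a 1)) => [[i j]|a] _; first by rewrite !ffunE.
  apply/ffunP => k; rewrite ffunE; case: eqVneq => [->//|k0].
  by congr (a _); apply/val_inj; case: k k0 => [[|[|]]].
apply: eq_bigr => [[i j]] _; rewrite /h /= !big_ord_recl big_ord0 mulr1 !ffunE /=.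
congr (c _ * _); first by apply/ffunP => k; rewrite !ffunE; case: eqP.
by congr (_ * x _ ^+ _); apply/val_inj.
Qed.

Lemma power_series_at2 (p : 'rV[C]_2) (f : 'rV[C]_2 -> C) :
  power_series_at p f <-> analytic_at p f.
Proof.
have normE (c : {ffun 'I_2 -> nat} -> C) N (r : C) : \sum_(a : {ffun 'I_2 -> 'I_N})
      `|c [ffun i => val (a i)]| * r ^+ (\sum_i a i)%N =
    psum (normco (fun i j => c [ffun k : 'I_2 => if k == 0 then i else j])) N N r r.
  rewrite -(sum_ffun_psum (fun a => `|c a|) N (fun=> r)).
  by apply: eq_bigr => a _; rewrite prodrXr.
split=> [[c [r [B [r0 cB cf]]]]|[c [r [r0 [B cB] cf]]]].
  exists (fun i j => c [ffun k : 'I_2 => if k == 0 then i else j]), r; split=> //.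
    by exists B => N; rewrite -normE.
  apply: filterS cf => z; rewrite (_ : (fun N => _) = (fun N =>
    psum (fun i j => c [ffun k : 'I_2 => if k == 0 then i else j]) N N
      (z 0 0 - p 0 0) (z 0 1 - p 0 1)))//.
  by apply/funext => N; rewrite (sum_ffun_psum c N (fun i => z 0 i - p 0 i)).
pose c' (a : {ffun 'I_2 -> nat}) := c (a 0) (a 1).
have c'E : (fun i j => c' [ffun k : 'I_2 => if k == 0 then i else j]) = c.
  by apply/funext => i; apply/funext => j; rewrite /c' !ffunE.
exists c', r, B; split=> // [N|]; first by rewrite normE c'E.
apply: filterS cf => z; rewrite [X in _ -> X @ _ --> _](_ : _ = (fun N =>
    psum c N N (z 0 0 - p 0 0) (z 0 1 - p 0 1)))//.
by apply/funext => N; rewrite (sum_ffun_psum c' N (fun i => z 0 i - p 0 i)) c'E.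
Qed.

End PowerSeries.

(** * Germs on an embedded space *)

Section Germs.
Variables (R : realType) (n : nat) (X : set 'rV[Cplx R]_n).
Local Notation E := (embedded X).
Implicit Types (o : E) (f g : E -> Cplx R).

Lemma germ_affine o f g (b : Cplx R) : germ o f -> germ o g ->
  germ o (fun q => f q + b * g q).
Proof.
move=> [F hF fF] [G hG gG]; exists (fun z => F z + b * G z).
  exact: (power_series_at_affine b hF hG).
by apply: filterS2 fF gG => q -> ->.
Qed.

Lemma germ_cst o (b : Cplx R) : germ o (fun=> b : Cplx R).
Proof.
exists (fun=> b); first exact: power_series_at_cst.
exact: (@filterE _ (nbhs o) _).
Qed.

Lemma germ_lincomb o k (G : 'I_k -> E -> Cplx R) (c : 'I_k -> Cplx R) :
  (forall i, germ o (G i)) -> germ o (fun q => \sum_i c i * G i q).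
Proof.
elim: k G c => [|k IH] G c hG.
  rewrite (_ : (fun q => _) = (fun=> 0 : Cplx R)); first exact: germ_cst.
  by apply/funext => q; rewrite big_ord0.
rewrite (_ : (fun q => _) = (fun q => (\sum_(i < k) c (lift ord0 i) * G (lift ord0 i) q)
   + c ord0 * G ord0 q)).
  by apply: germ_affine; [apply: IH => i|].
by apply/funext => q; rewrite big_ord_recl [LHS]addrC.
Qed.

Lemma LC_maximal_ideal o k (G : 'I_k -> E -> Cplx R) :
  generating_system o (maximal_ideal o) G -> LC G `<=` maximal_ideal o.
Proof.
move=> [mG _] h [c ->]; split; first by apply: germ_lincomb => i; case: (mG i).
by rewrite big1// => i _; have [_ ->] := mG i; rewrite mulr0.
Qed.

(** The germ [f - f o] lies in the ideal.  This is the expansion that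
    [divisible_wedge] iterates. *)
Lemma germ_generation o k (G : 'I_k -> E -> Cplx R) f :
    generating_system o (maximal_ideal o) G -> germ o f ->
  exists c : 'I_k -> E -> Cplx R, (forall i, germ o (c i)) /\
    \forall q \near o, f q = f o + \sum_i c i q * G i q.
Proof.
move=> [_ gen] hf.
have [|c [hc fc]] := gen (fun q => f q + (- f o) * 1).
  split; last by rewrite mulr1 subrr.
  by apply: (germ_affine _ hf); exact: germ_cst.
exists c; split=> //; apply: filterS fc => q <-.
by rewrite mulr1 addrC subrK.
Qed.

Lemma LC_generator k (G : 'I_k -> E -> Cplx R) i : LC G (G i).
Proof.
exists (fun j => (j == i)%:R); apply/funext => q.
rewrite (bigD1 i)//= eqxx mul1r big1 ?addr0// => j /negPf ->.
by rewrite mul0r.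
Qed.

End Germs.

(** * Suprema of sets of natural numbers *)

Section Order.
Variables (R : realType) (I : Type).

Lemma ereal_sup_nat_setT : ereal_sup [set k%:R%:E | k in [set: nat]] = +oo%E :> \bar R.
Proof.
apply/eqyP => r r0; have [N rN] : exists N : nat, r <= N%:R.
  by exists (Num.truncn r).+1; apply: ltW; exact: truncnS_gt.
by apply: (@le_trans _ _ (N%:R%:E)); rewrite ?lee_fin//; apply: ereal_sup_ubound; exists N.
Qed.

(** If [B] omits [t] then so does some [A i], which then lies below [t] and
    hence in [B]. *)
Lemma ereal_sup_nat_inter (A : I -> set nat) (B : set nat) (y : \bar R) :
    (forall i s t, (s <= t)%N -> A i t -> A i s) ->
    (forall t, (forall i, A i t) -> B t) ->
    (forall i, (y <= ereal_sup [set k%:R%:E | k in A i])%E) ->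
  (y <= ereal_sup [set k%:R%:E | k in B])%E.
Proof.
move=> Adown AB yA; have [BT|/existsNP[t nBt]] := pselect (forall t, B t).
  have -> : B = setT by apply/seteqP; split.
  by rewrite ereal_sup_nat_setT leey.
pose P t := `[< ~ B t >].
have exP : exists t, P t by exists t; apply/asboolP.
case: (ex_minnP exP) => m /asboolP nBm mmin.
have [i nAi] : exists i, ~ A i m by apply/existsNP => Am; apply/nBm/AB.
apply: le_trans (yA i) _; apply: ereal_sup_le => _ [s As <-].
exists s => //; apply: contrapT => nBs; apply: nAi.
by apply: Adown As; apply: mmin; apply/asboolP.
Qed.

End Order.

(** * Orders of vanishing along a component *)

Section LocalOrder.
Variables (R : realType) (n : nat) (X : set 'rV[Cplx R]_n) (o : embedded X).
Variables (M : cspace R) (pi : M -> embedded X).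
Hypothesis pi_holo : holomorphic_map setT pi.
Variable Ev : set M.
Hypothesis Ev_o : Ev `<=` pi @^-1` [set o].
Variables (k : nat) (G : 'I_k -> embedded X -> Cplx R).
Hypothesis G_gen : generating_system o (maximal_ideal o) G.

Lemma vanishesE (u : chart M 2 -> 'rV[Cplx R]_2 -> Cplx R) t :
  vanishes_to_order Ev u t <->
  forall p phi, Ev p -> adapted_chart Ev p phi ->
    @divisible (Cplx R) (cmap phi p) t (u phi).
Proof.
split=> H p phi Ep ad; have [g hg ug] := H p phi Ep ad; exists g => //.
- by apply/power_series_at2; exact: hg.
- by apply/power_series_at2; exact: hg.
Qed.

Section AtChart.
Variables (p : M) (phi : chart M 2).
Hypotheses (Ep : Ev p) (p_phi : adapted_chart Ev p phi).
Local Notation z0 := (cmap phi p : 'rV[Cplx R]_2).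
Local Notation pull h := (in_chart (h \o pi) phi).

Lemma adapted_coord0 : z0 0 0 = 0.
Proof. by have [dp /(_ _ dp)[+ _]] := p_phi; apply. Qed.

Lemma cinvK_at : cinv phi z0 = p.
Proof.
by have [dp _] := p_phi; have [_ /(_ p dp)[_ ->]] := chart_biholomorphism phi.
Qed.

Lemma cimg_at : cimg phi z0.
Proof.
by have [dp _] := p_phi; have [_ /(_ p dp)[? _]] := chart_biholomorphism phi.
Qed.

Lemma near_pull (P : set (embedded X)) : (\forall q \near o, P q) ->
  \forall z \near z0, P (pi (cinv phi z)).
Proof.
move=> Po; have [_ _ _ _ /(_ _ cimg_at)[cont_inv _]] := chart_biholomorphism phi.
have [cont_pi _] := pi_holo (I : setT p).
apply: (cont_inv (fun m => P (pi m))); rewrite cinvK_at.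
by apply: (cont_pi P); rewrite (Ev_o Ep).
Qed.

Lemma analytic_pull h : germ o h -> @analytic_at (Cplx R) z0 (pull h).
Proof.
move=> ho; have [_ _ _ _ /(_ _ cimg_at)[_ germ_inv]] := chart_biholomorphism phi.
have [_ germ_pi] := pi_holo (I : setT p).
apply/power_series_at2; apply: germ_inv; rewrite cinvK_at; apply: germ_pi.
by rewrite (Ev_o Ep).
Qed.

Lemma near_pull_zero h : \forall z \near z0, (z : 'rV[Cplx R]_2) 0 0 = 0 -> pull h z = h o.
Proof.
have [[_ oV] _ VK _ _] := chart_biholomorphism phi.
have : \forall z \near z0, cimg phi z by exact: open_nbhs_nbhs (conj oV cimg_at).
apply: filterS => z /VK[Uz zK] z00; rewrite /in_chart /=.
suff /Ev_o -> : Ev (cinv phi z) by [].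
by apply/(p_phi.2 _ Uz); rewrite zK.
Qed.

Lemma generator_divisible i : @divisible (Cplx R) z0 1 (pull (G i)).
Proof.
have [hG G0] := G_gen.1 i.
apply: (divisible_of_zero (@Cplx_complete R) adapted_coord0 (analytic_pull hG)).
by apply: filterS (near_pull_zero (G i)) => z h z00; rewrite h.
Qed.

Lemma divisible_ideal t h : maximal_ideal o h ->
  (forall i, @divisible (Cplx R) z0 t (pull (G i))) -> @divisible (Cplx R) z0 t (pull h).
Proof.
move=> mh dG; have [c [hc hE]] := G_gen.2 h mh.
apply: (@divisible_eq _ _ _ (fun z => \sum_i pull (c i) z * pull (G i) z)).
  by apply: filterS (near_pull hE) => z.
apply: divisible_sum => i.
by apply: (divisible_mull (@Cplx_complete R)); [exact: analytic_pull|].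
Qed.

Lemma divisible_wedge_pull t f h : germ o f -> germ o h ->
    (forall i j, @divisible (Cplx R) z0 t (wedge_in_chart (G i \o pi) (G j \o pi) phi)) ->
  @divisible (Cplx R) z0 t (wedge_in_chart (f \o pi) (h \o pi) phi).
Proof.
move=> of_ oh gg.
apply: (@divisible_wedge (Cplx R) (@Cplx_complete R) z0 k (fun i => pull (G i))
  [set pull a | a in germ o] t adapted_coord0) => //.
- by move=> _ [a oa <-]; exact: analytic_pull.
- by move=> i; exists (G i) => //; case: (G_gen.1 i).
- exact: generator_divisible.
- move=> _ [a oa <-]; have [c [hc aE]] := germ_generation G_gen oa.
  exists (a o), (fun i => pull (c i)); split; first by move=> i; exists (c i).
  by apply: filterS (near_pull aE) => z.
- by exists f.
- by exists h.
Qed.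

End AtChart.

Lemma vanishes_down u s t : (s <= t)%N -> vanishes_to_order Ev u t ->
  vanishes_to_order Ev u s.
Proof.
move=> st /vanishesE ut; apply/vanishesE => p phi Ep ad.
exact: (divisibleW (@Cplx_complete R) (adapted_coord0 Ep ad) st (ut p phi Ep ad)).
Qed.

Lemma m_inf_LC : m_inf pi Ev (LC G) = m_inf pi Ev (maximal_ideal o).
Proof.
apply/eqP; rewrite eq_le; apply/andP; split; last first.
  apply: ereal_inf_le_tmp => _ [h Gh <-]; exists h => //.
  exact: (LC_maximal_ideal G_gen).
apply: le_ereal_inf_tmp => _ [h mh <-].
apply: (@ereal_sup_nat_inter _ _ (fun i => vanishes_to_order Ev (in_chart (G i \o pi)))).
- by move=> i s t; exact: vanishes_down.
- move=> t Gt; apply/vanishesE => p phi Ep ad.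
  apply: (divisible_ideal Ep ad mh) => i.
  by have /vanishesE := Gt i; apply.
- by move=> i; apply: ereal_inf_lbound; exists (G i) => //; exact: LC_generator.
Qed.

Lemma nu_inf_LC : nu_inf pi Ev (LC G) = nu_inf pi Ev (maximal_ideal o).
Proof.
apply/eqP; rewrite eq_le; apply/andP; split; last first.
  apply: ereal_inf_le_tmp => _ [[h1 h2] [Gh1 Gh2] <-]; exists (h1, h2) => //.
  by split; exact: (LC_maximal_ideal G_gen).
apply: le_ereal_inf_tmp => _ [[h1 h2] [[oh1 _] [oh2 _]] <-].
apply: (@ereal_sup_nat_inter _ ('I_k * 'I_k)%type (fun ij =>
  vanishes_to_order Ev (wedge_in_chart (G ij.1 \o pi) (G ij.2 \o pi)))).
- by move=> i s t; exact: vanishes_down.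
- move=> t Gt; apply/vanishesE => p phi Ep ad.
  apply: (divisible_wedge_pull Ep ad oh1 oh2) => i j.
  by have /vanishesE := Gt (i, j); apply.
- move=> [i j]; apply: ereal_inf_lbound; exists (G i, G j) => //.
  by split; exact: LC_generator.
Qed.

End LocalOrder.

Theorem lemma2p3 (R : realType) (n : nat) (X : set 'rV[Cplx R]_n)
    (o : embedded X) (ho : set_val o = 0%R)
    (hX : isolated_surface_singularity o)
    (k : nat) (G : 'I_k -> embedded X -> Cplx R)
    (hG : generating_system o (maximal_ideal o) G)
    (M : cspace R) (pi : M -> embedded X) (hpi : good_resolution o pi)
    (Ev : set M) (hEv : irreducible_component (pi @^-1` [set o])%classic Ev) :
  [/\ m_inf pi Ev (LC G) = m_inf pi Ev (maximal_ideal o),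
      nu_inf pi Ev (LC G) = nu_inf pi Ev (maximal_ideal o) &
      q_inf pi Ev (LC G) = q_inf pi Ev (maximal_ideal o)].
Proof.
have [_ [pi_holo _] _ _ _] := hpi; have [_ Ev_o _] := hEv.
have m_eq := m_inf_LC pi_holo Ev_o hG; have nu_eq := nu_inf_LC pi_holo Ev_o hG.
by split=> //; rewrite /q_inf m_eq nu_eq.
Qed.
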